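(* (I) For any $M\in\mathbb{N}$, $M\ge1$, and any $\rho\in(0,\infty)$, there exist complex numbers $a_n=|a_n|e^{i\theta_n}$ ($\theta_n\in\mathbb{R}$, $n\ge1$) such that - the Dirichlet series $\sum a_n n^{-s}$ has abscissa of absolute convergence $\sigma_a=0$; - $(|a_{Ml+1}|,|a_{Ml+2}|,\ldots,|a_{Ml+M}|)\in B^{\rho}$ for all $l=0,1,2,\ldots$; - $(\cos\theta_{Ml+1},\cos\theta_{Ml+2},\ldots,\cos\theta_{Ml+M})\in-\left(B^{\rho}\right)^{\sharp}$ for all $l=0,1,2,\ldots$; - $\sum a_n n^{-s}$ has a holomorphic extension past $s=0$. (II) For any $M\in\mathbb{N}$ with $M\ge2$ and any $0<\rho'<\rho$, there exist $\gamma>0$ and complex numbers $a_n=|a_n|e^{i\theta_n}$ ($\theta_n\in\mathbb{R}$, $n\ge1$) such that - the Dirichlet series $\sum a_n n^{-s}$ has abscissa of absolute convergence $\sigma_a=0$; - $(|a_{Ml+1}|,|a_{Ml+2}|,\ldots,|a_{Ml+M}|)\in B^{\rho}$ for all $l=0,1,2,\ldots$; - $(\cos\theta_{Ml+1},\cos\theta_{Ml+2},\ldots,\cos\theta_{Ml+M})\in-\left(B^{\rho'}\right)^{\sharp}+\gamma(1,1,\ldots,1)$ for all $l=0,1,2,\ldots$; - $\sum a_n n^{-s}$ has a holomorphic extension past $s=0$.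
   Context: The abscissa of absolute convergence of $\sum a_n n^{-s}$ is $\sigma_a=\inf\{\sigma\in\mathbb{R}:\sum a_n n^{-s}\text{ converges absolutely for all } s \text{ with } \Re s>\sigma\}$. When $\sigma_a=0$, the sum $f(s)=\sum a_n n^{-s}$ is holomorphic on $\Omega_0=\{s\in\mathbb{C}:\Re s>0\}$; having a holomorphic extension past $s=0$ means that $f$ extends holomorphically to a neighborhood of $s=0$, i.e. there are $r>0$ and a holomorphic function on $\Omega_0\cup\{|s|<r\}$ which agrees with $f$ on $\Omega_0$. For $\rho\in(0,\infty)$ and $M\ge1$, $$B^{\rho}=B^{\rho,M}=\{\beta=(\beta_1,\ldots,\beta_M)\in[0,\infty)^M:\ \beta_1\le\rho\beta_2\le\rho^2\beta_3\le\cdots\le\rho^{M-1}\beta_M\}.$$ For a convex cone $C\subset\mathbb{R}^M$, the polar cone is $C^{\sharp}=\{x\in\mathbb{R}^M: x\cdot c\le 0\ \ \forall c\in C\}$, where $x\cdot c$ is the standard inner product. For a set $S\subset\mathbb{R}^M$ and $v\in\mathbb{R}^M$, $-S=\{-x:x\in S\}$ and $S+v=\{x+v:x\in S\}$. *)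

(* Defs.v *)
From Stdlib Require Import Reals.
From mathcomp Require Import ssreflect ssrfun ssrbool fintype bigop.
From Coquelicot Require Import Coquelicot.

Local Open Scope R_scope.

Definition Cexp (z : C) : C :=
  (exp (Re z) * cos (Im z), exp (Re z) * sin (Im z)).

(* Coefficient sequences are [a : nat -> C]; only the values [a n] with
   [1 <= n] are used.  The power [n^(-s)] is [exp (- s ln n)]. *)
Definition dirichlet_term (a : nat -> C) (s : C) (n : nat) : C :=
  (a n * Cexp (- s * RtoC (ln (INR n))))%C.

Definition dirichlet_abs_cv (a : nat -> C) (s : C) : Prop :=
  ex_series (fun k : nat => Cmod (dirichlet_term a s (S k))).

Definition is_dirichlet_sum (a : nat -> C) (s l : C) : Prop :=
  @is_series C_AbsRing C_NormedModule
    (fun k : nat => dirichlet_term a s (S k)) l.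

Definition abscissa_abs_cv (a : nat -> C) : Rbar :=
  Glb_Rbar (fun sigma : R =>
    forall s : C, sigma < Re s -> dirichlet_abs_cv a s).

(* Complex differentiability at every point of [U]; used only for open [U]. *)
Definition holomorphic_on (U : C -> Prop) (f : C -> C) : Prop :=
  forall z : C, U z -> @ex_derive C_AbsRing C_NormedModule f z.

Definition has_holomorphic_extension_past_0 (a : nat -> C) : Prop :=
  exists (r : R) (F : C -> C),
    0 < r /\
    holomorphic_on (fun s : C => 0 < Re s \/ Cmod s < r) F /\
    (forall s : C, 0 < Re s -> is_dirichlet_sum a s (F s)).

Definition dot (M : nat) (x y : 'I_M -> R) : R :=
  \big[Rplus/0]_(i < M) (x i * y i).

(* Coordinates are indexed from 0, so the chain
   [beta_1 <= rho beta_2 <= ... <= rho^(M-1) beta_M] reads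
   [rho^i beta_i <= rho^(i+1) beta_(i+1)] for [0 <= i] and [i + 1 < M]. *)
Definition Bcone (M : nat) (rho : R) (beta : 'I_M -> R) : Prop :=
  (forall i : 'I_M, 0 <= beta i) /\
  (forall i j : 'I_M, nat_of_ord j = S (nat_of_ord i) ->
     rho ^ i * beta i <= rho ^ j * beta j).

Definition polar (M : nat) (K : ('I_M -> R) -> Prop) (x : 'I_M -> R) : Prop :=
  forall c : 'I_M -> R, K c -> dot M x c <= 0.

Definition opp_set (M : nat) (S : ('I_M -> R) -> Prop) (x : 'I_M -> R) : Prop :=
  exists y : 'I_M -> R, S y /\ forall i : 'I_M, x i = - y i.

Definition translate_set (M : nat) (S : ('I_M -> R) -> Prop) (v : 'I_M -> R)
    (x : 'I_M -> R) : Prop :=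
  exists y : 'I_M -> R, S y /\ forall i : 'I_M, x i = y i + v i.

(* The [l]-th block [(u_(M l + 1), ..., u_(M l + M))] of a sequence. *)
Definition block (M : nat) (u : nat -> R) (l : nat) (i : 'I_M) : R :=
  u (M * l + S (nat_of_ord i))%nat.

Definition has_arguments (a : nat -> C) (theta : nat -> R) : Prop :=
  forall n : nat, (1 <= n)%nat ->
    a n = (RtoC (Cmod (a n)) * Cexp (Ci * RtoC (theta n)))%C.

(* Main.v *)
(* Both parts use a Dirichlet series supported on the points [P 2^k + j] with
   finitely many offsets [j] and coefficients [c_j] that do not depend on [k] and
   have sum 0.  Its coefficients do not tend to 0, so its abscissa of absolute
   convergence is 0.  Since the [c_j] cancel, the sum equals
     [sum_j c_j sum_k ((P 2^k + j)^(-s) - (P 2^k)^(-s))],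
   and the [k]-th difference and its first two derivatives are bounded by
   [2^(-k (1 + Re s))] up to polynomial factors in [k], locally uniformly in [s].
   Hence this double sum is holomorphic also to the left of 0.

   With a multiple [D] of [M] and [P = 4 D], the coefficients are
     [c_D = e^(i phi)], [c_(D-1) = r e^(i psi)], [c_(2D) = conj c_D],
     [c_(2D-1) = conj c_(D-1)],
   with [cos phi + r cos psi = 0] to make the sum vanish.  Part (I) takes [r = 0]
   and [phi = pi/2].  Part (II) takes [D = M], [r = rho], [cos phi = min 1 rho]
   and [cos psi = - cos phi / rho]: the smaller weight [rho' < rho] that the cone
   [B^rho'] allows at the offset [D - 1] leaves room for [gamma]. *)
Require Import Defs.
From Stdlib Require Import Reals Lra Lia.
From mathcomp Require Import ssreflect ssrfun ssrbool fintype bigop.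
From Coquelicot Require Import Coquelicot.
Local Open Scope R_scope.

(** * Taylor bounds for the exponential *)

Lemma Cexp_add (z w : C) : Cexp (z + w) = (Cexp z * Cexp w)%C.
Proof.
rewrite /Cexp /Cmult /Re /Im /= exp_plus cos_plus sin_plus.
by apply: injective_projections => /=; ring.
Qed.

Lemma Cmod_Cexp (z : C) : Cmod (Cexp z) = exp (Re z).
Proof.
have He := exp_pos (Re z).
rewrite /Cexp /Cmod /=; set e := exp _ in He *.
replace (_ + _) with (e ^ 2 * (Rsqr (sin (Im z)) + Rsqr (cos (Im z)))); last first.
  by rewrite /Rsqr; ring.
by rewrite sin2_cos2 Rmult_1_r sqrt_pow2 //; lra.
Qed.

Lemma Rabs_le_intro (x y : R) : x <= y -> - x <= y -> Rabs x <= y.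
Proof. by move=> *; apply: Rabs_le; lra. Qed.

Lemma exp_sub_1_bound (x : R) : Rabs (exp x - 1) <= Rabs x * exp (Rabs x).
Proof.
have H1 := exp_ineq1_le x.
have H2 := exp_ineq1_le (- x).
have Hp := exp_pos x.
have Hi : exp x * exp (- x) = 1 by rewrite -exp_plus Rplus_opp_r exp_0.
have H3 := exp_ineq1_le (Rabs x).
case: (Rle_lt_dec 0 x) => Hx.
  rewrite (Rabs_pos_eq x) // in H3 *.
  by apply: Rabs_le_intro; nra.
rewrite (Rabs_left x) // in H3 *.
by apply: Rabs_le_intro; nra.
Qed.

(** The inequality [1 + y <= exp y] at [y = x] and [y = - x] places the remainder between 0 and
    [x (exp x - 1)]. *)
Lemma exp_sub_1_id_bound (x : R) :
  Rabs (exp x - 1 - x) <= x ^ 2 * exp (Rabs x).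
Proof.
have H1 := exp_ineq1_le x.
have H2 := exp_ineq1_le (- x).
have Hp := exp_pos x.
have Hi : exp x * exp (- x) = 1 by rewrite -exp_plus Rplus_opp_r exp_0.
have K : exp x - 1 <= x * exp x by nra.
have H3 := exp_ineq1_le (Rabs x).
have H4 := Rabs_pos x.
have H0 : 0 <= x ^ 2 * exp (Rabs x) by apply: Rmult_le_pos; nra.
apply: Rabs_le_intro; last by lra.
apply: (Rle_trans _ (x * (exp x - 1))); first by lra.
case: (Rle_lt_dec 0 x) => Hx.
  rewrite (Rabs_pos_eq x) //.
  by apply: (Rle_trans _ (x * (x * exp x))); nra.
by apply: (Rle_trans _ (x ^ 2)); nra.
Qed.

Lemma Rabs_sin_le (x : R) : Rabs (sin x) <= Rabs x.
Proof.
have [c [Hc _]] := MVT_abs sin cos 0 x (fun c _ => derivable_pt_lim_sin c).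
rewrite sin_0 !Rminus_0_r in Hc; rewrite Hc.
have := Rabs_pos x.
have : Rabs (cos c) <= 1 by apply: Rabs_le; apply: COS_bound.
by nra.
Qed.

Lemma cos_sub_1_bound (x : R) : Rabs (cos x - 1) <= x ^ 2.
Proof.
have -> : cos x - 1 = - (2 * (sin (x / 2) * sin (x / 2))).
  have := cos_2a_sin (x / 2).
  replace (2 * (x / 2)) with x by field.
  by lra.
have := Rabs_sin_le (x / 2).
rewrite Rabs_Ropp Rabs_mult (Rabs_pos_eq 2); last lra.
rewrite Rabs_mult (_ : x ^ 2 = 4 * (Rabs (x / 2) * Rabs (x / 2))); last first.
  by rewrite -Rabs_mult Rabs_pos_eq; [field|nra].
have := Rabs_pos (sin (x / 2)).
by nra.
Qed.

Lemma sin_sub_id_bound (x : R) : Rabs (sin x - x) <= x ^ 2.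
Proof.
have [c [Hc Hc2]] := MVT_abs (fun x => sin x - x) (fun x => cos x - 1) 0 x
  (fun c _ => derivable_pt_lim_minus _ _ _ _ _ (derivable_pt_lim_sin c)
     (derivable_pt_lim_id c)).
rewrite sin_0 !Rminus_0_r in Hc; rewrite Hc.
have Hcos : Rabs (cos c - 1) <= Rabs x.
  have [d [Hd _]] := MVT_abs cos (fun x => - sin x) 0 c
    (fun c _ => derivable_pt_lim_cos c).
  rewrite cos_0 !Rminus_0_r in Hd; rewrite Hd Rabs_Ropp.
  have : Rabs (sin d) <= 1 by apply: Rabs_le; apply: SIN_bound.
  have : Rabs c <= Rabs x.
    by move: Hc2; rewrite /Rmin /Rmax /Rabs; case: Rle_dec; case: Rcase_abs;
      case: Rcase_abs; lra.
  have := Rabs_pos c; have := Rabs_pos (sin d); nra.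
by rewrite -Rsqr_pow2 Rsqr_abs /Rsqr; have := Rabs_pos x; nra.
Qed.

Lemma Cmod_le_Rabs (z : C) : Cmod z <= Rabs (Re z) + Rabs (Im z).
Proof.
have -> : z = (RtoC (Re z) + Ci * RtoC (Im z))%C.
  by apply: injective_projections => /=; rewrite /Re /Im /=; ring.
apply: Rle_trans (Cmod_triangle _ _) _.
rewrite Cmod_mult Cmod_Ci !Cmod_R /Re /Im /=.
by apply: Req_le; congr (Rabs _ + _); [ring | rewrite Rmult_1_l; congr Rabs; ring].
Qed.

Lemma Rabs_Im_le (z : C) : Rabs (Im z) <= Cmod z.
Proof. exact: Rle_trans (Rmax_r _ _) (Rmax_Cmod z). Qed.

Lemma exp_le (x y : R) : x <= y -> exp x <= exp y.
Proof. by case=> [H|->]; [left; apply: exp_increasing | right]. Qed.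

(** Real and imaginary parts reduce to the remainders of [exp], [cos] and [sin]; each part is at
    most [2 m^2 E] with [m = Cmod z] and [E = exp m]. *)
Lemma Cexp_sub_1_id_bound (z : C) :
  Cmod (Cexp z - 1 - z) <= 5 * Cmod z ^ 2 * exp (Cmod z).
Proof.
apply: Rle_trans (Cmod_le_Rabs _) _.
rewrite /Cexp /Re /Im /=; set x := z.1; set y := z.2.
have Hx : Rabs x <= Cmod z := re_le_Cmod z.
have Hy : Rabs y <= Cmod z := Rabs_Im_le z.
have Hx0 := Rabs_pos x; have Hy0 := Rabs_pos y.
have He : exp (Rabs x) <= exp (Cmod z) by apply: exp_le.
have He1 : 1 <= exp (Cmod z).
  by have := exp_ineq1_le (Cmod z); have := Cmod_ge_0 z; lra.
have Hex : exp x <= exp (Cmod z).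
  by apply: exp_le; have := Rle_abs x; lra.
have Hex0 := exp_pos x.
have A1 := exp_sub_1_bound x; have A2 := exp_sub_1_id_bound x.
have A3 := cos_sub_1_bound y; have A4 := sin_sub_id_bound y.
have Ex2 : x ^ 2 <= Cmod z ^ 2 by rewrite -pow2_abs; apply: pow_incr.
have Ey2 : y ^ 2 <= Cmod z ^ 2 by rewrite -pow2_abs; apply: pow_incr.
have Hxy : Rabs x * Rabs y <= Cmod z ^ 2 by nra.
set E := exp (Cmod z) in He He1 Hex *; set m := Cmod z in Hx Hy Ex2 Ey2 Hxy *.
have B1 : Rabs (exp x * cos y + - (1) + - x) <= 2 * m ^ 2 * E.
  replace (_ + _) with (exp x * (cos y - 1) + (exp x - 1 - x)) by ring.
  apply: Rle_trans (Rabs_triang _ _) _.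
  rewrite Rabs_mult (Rabs_pos_eq (exp x)); last lra.
  have : exp x * Rabs (cos y - 1) <= E * m ^ 2.
    by apply: Rmult_le_compat; try lra; apply: Rabs_pos.
  have : x ^ 2 * exp (Rabs x) <= m ^ 2 * E.
    by apply: Rmult_le_compat; try lra; [nra | have := exp_pos (Rabs x); lra].
  by lra.
have B2 : Rabs (exp x * sin y + - 0 + - y) <= 2 * m ^ 2 * E.
  replace (_ + _) with (exp x * (sin y - y) + (exp x - 1) * y) by ring.
  apply: Rle_trans (Rabs_triang _ _) _.
  rewrite !Rabs_mult (Rabs_pos_eq (exp x)); last lra.
  have : exp x * Rabs (sin y - y) <= E * m ^ 2.
    by apply: Rmult_le_compat; try lra; apply: Rabs_pos.
  have : Rabs (exp x - 1) * Rabs y <= m ^ 2 * E.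
    apply: Rle_trans (Rmult_le_compat_r _ _ _ Hy0 A1) _.
    replace (_ * _) with ((Rabs x * Rabs y) * exp (Rabs x)) by ring.
    by apply: Rmult_le_compat; try lra; [nra | have := exp_pos (Rabs x); lra].
  by lra.
have : 0 <= m ^ 2 * E by nra.
lra.
Qed.

(** The doubled exponent absorbs the square: [m <= exp m] gives [m^2 exp m <= m exp (2 m)]. *)
Lemma Cexp_sub_1_bound (z : C) :
  Cmod (Cexp z - 1) <= 6 * Cmod z * exp (2 * Cmod z).
Proof.
replace (Cexp z - 1)%C with ((Cexp z - 1 - z) + z)%C by ring.
apply: Rle_trans (Cmod_triangle _ _) _.
have H := Cexp_sub_1_id_bound z.
have H0 := Cmod_ge_0 z.
have H1 := exp_ineq1_le (Cmod z).
have -> : exp (2 * Cmod z) = exp (Cmod z) * exp (Cmod z).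
  by rewrite -exp_plus; congr exp; ring.
set m := Cmod z in H H0 H1 *; set E := exp m in H H1 *.
have : 0 <= (m * E) * (E - m) by apply: Rmult_le_pos; nra.
have : 1 <= E * E by nra.
nra.
Qed.

(** * Holomorphy of series *)

Notation is_Cseries := (@is_series C_AbsRing C_NormedModule).

(** Total, like the real [Series], so that a sum of functions can be named before convergence is
    known. *)
Definition CSeries (z : nat -> C) : C :=
  (Series (fun k => Re (z k)), Series (fun k => Im (z k))).

Lemma CSeries_correct (z : nat -> C) :
  ex_series (fun k => Cmod (z k)) -> is_Cseries z (CSeries z).
Proof.
move=> Hz.
have HR : ex_series (fun k => Re (z k)).
  by apply: (ex_series_le (V := R_CompleteNormedModule) _ _ _ Hz) => k; apply: re_le_Cmod.
have HI : ex_series (fun k => Im (z k)).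
  by apply: (ex_series_le (V := R_CompleteNormedModule) _ _ _ Hz) => k; apply: Rabs_Im_le.
move/Series_correct/filterlim_locally: HR => HR.
move/Series_correct/filterlim_locally: HI => HI.
apply/filterlim_locally => eps.
apply: filter_imp (filter_and _ _ (HR eps) (HI eps)) => n [].
have -> : sum_n z n =
    (sum_n (fun k => Re (z k)) n, sum_n (fun k => Im (z k)) n) :> C.
  elim: n => [|n IH]; first by rewrite !sum_O; case: (z 0%nat).
  by rewrite !sum_Sn IH; apply: injective_projections.
by move=> B1 B2; split.
Qed.

Lemma Cmod_series_le (z : nat -> C) (b : nat -> R) (l : C) (L : R) :
  is_Cseries z l -> is_series b L -> (forall k, Cmod (z k) <= b k) ->
  Cmod l <= L.
Proof.
move=> Hz Hb Hle.
apply: (is_lim_seq_le (fun n => Cmod (sum_n z n)) (sum_n b) (Cmod l) L) => //.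
- move=> n; elim: n => [|n IH]; first by rewrite !sum_O.
  rewrite !sum_Sn; apply: Rle_trans (Cmod_triangle _ _) _.
  exact: Rplus_le_compat.
- rewrite /is_lim_seq.
  have -> : Rbar_locally (Cmod l) = locally (Cmod l) by [].
  have H := filterlim_comp _ _ _ _ _ _ _ _ Hz
    (@filterlim_norm C_AbsRing C_NormedModule l).
  exact: H.
Qed.

(** A quantitative form of differentiability with derivative [d] at [z]: the single constant [K]
    also controls a quadratic remainder on a fixed disc. Such bounds pass to products and to sums
    over [k]. *)
Definition jet_bound (f : C -> C) (z d : C) (K : R) : Prop :=
  Cmod (f z) <= K /\ Cmod d <= K /\
  forall h : C, Cmod h <= 1 / 4 ->
    Cmod (f (z + h) - f z - d * h)%C <= K * Cmod h ^ 2.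

(** The remainder of the product splits into [f z] times the remainder of [g], the cross term
    [d h (g (z + h) - g z)], and the remainder of [f] times [g (z + h)]. With [m = Cmod h] they
    total at most [K L m^2 (3 + 2 m + m^2)], and [m <= 1/4] gives the factor 5. *)
Lemma jet_bound_mult (f g : C -> C) (z d e : C) (K L : R) :
  jet_bound f z d K -> jet_bound g z e L ->
  jet_bound (fun s => f s * g s)%C z (f z * e + d * g z)%C (5 * K * L).
Proof.
move=> [Hf [Hd Hfr]] [Hg [He Hgr]].
have HK : 0 <= K by have := Cmod_ge_0 d; lra.
have HL : 0 <= L by have := Cmod_ge_0 e; lra.
have HKL : 0 <= K * L by nra.
have mulb (u v : C) (a b : R) : Cmod u <= a -> Cmod v <= b -> Cmod (u * v)%C <= a * b.
  move=> Hu Hv; rewrite Cmod_mult.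
  by apply: Rmult_le_compat => //; apply: Cmod_ge_0.
have addb (u v : C) (a b : R) : Cmod u <= a -> Cmod v <= b -> Cmod (u + v)%C <= a + b.
  move=> Hu Hv; apply: Rle_trans (Cmod_triangle _ _) _; lra.
split; last split.
- by apply: Rle_trans (mulb _ _ _ _ Hf Hg) _; nra.
- apply: Rle_trans (addb _ _ _ _ (mulb _ _ _ _ Hf He) (mulb _ _ _ _ Hd Hg)) _.
  by nra.
move=> h Hh; have H0 := Cmod_ge_0 h.
move: (Hfr h Hh) (Hgr h Hh).
set r := (_ - _ - d * h)%C; set q := (_ - _ - e * h)%C => Hr Hq.
replace (_ - _ - _)%C with
  (f z * q + d * h * (g (z + h)%C - g z) + r * g (z + h)%C)%C; last first.
  by rewrite /q /r; ring.
have Hm := Cmod_ge_0 h.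
have Hdiff : Cmod (g (z + h)%C - g z)%C <= L * Cmod h + L * Cmod h ^ 2.
  replace (_ - _)%C with (e * h + q)%C by (rewrite /q; ring).
  by apply: addb => //; apply: mulb => //; lra.
have Hgh : Cmod (g (z + h)%C) <= L + (L * Cmod h + L * Cmod h ^ 2).
  by replace (g _) with (g z + (g (z + h) - g z))%C; [apply: addb | ring].
have Hdh := mulb _ _ _ _ Hd (Rle_refl (Cmod h)).
apply: Rle_trans (addb _ _ _ _ (addb _ _ _ _ (mulb _ _ _ _ Hf Hq)
   (mulb _ _ _ _ Hdh Hdiff)) (mulb _ _ _ _ Hr Hgh)) _.
set m := Cmod h in Hh Hm *.
have -> : K * (L * m ^ 2) + K * m * (L * m + L * m ^ 2) +
   K * m ^ 2 * (L + (L * m + L * m ^ 2)) = (K * L * m ^ 2) * (3 + 2 * m + m ^ 2) by ring.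
have -> : 5 * K * L * m ^ 2 = (K * L * m ^ 2) * 5 by ring.
by apply: Rmult_le_compat_l; nra.
Qed.

Lemma jet_bound_near (f : C -> C) (z d h : C) (K : R) :
  jet_bound f z d K -> Cmod h <= 1 / 4 -> Cmod (f (z + h)%C) <= 3 * K.
Proof.
move=> [Hf [Hd Hr]] Hh; have H0 := Cmod_ge_0 h; have Hd0 := Cmod_ge_0 d.
replace (f _) with (f z + d * h + (f (z + h) - f z - d * h))%C by ring.
apply: Rle_trans (Cmod_triangle _ _) _.
have H1 := Cmod_triangle (f z) (d * h).
rewrite Cmod_mult in H1.
have : Cmod h ^ 2 <= 1 by nra.
have := Hr h Hh; nra.
Qed.

(** Summing the jets over [k] leaves a remainder of at most [Series K * Cmod h ^ 2], so the
    derivative is the sum of the [d k]. *)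
Lemma ex_derive_series (f : nat -> C -> C) (z : C) (d : nat -> C)
    (K : nat -> R) :
  ex_series K ->
  (forall k, jet_bound (f k) z (d k) (K k)) ->
  @ex_derive C_AbsRing C_NormedModule (fun s => CSeries (fun k => f k s)) z.
Proof.
move=> HK Hj.
set F := fun s : C => _.
have HF h : Cmod h <= 1 / 4 -> is_Cseries (fun k => f k (z + h)%C) (F (z + h)%C).
  move=> Hh; apply: CSeries_correct.
  apply: (ex_series_le (V := R_CompleteNormedModule) _ (fun k => 3 * K k)).
    move=> k; rewrite /norm /= /abs /= Rabs_pos_eq; last exact: Cmod_ge_0.
    by apply: jet_bound_near (Hj k) Hh.
  exact: (@ex_series_scal R_AbsRing R_NormedModule 3 K).
have HD : is_Cseries d (CSeries d).
  apply: CSeries_correct.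
  apply: (ex_series_le (V := R_CompleteNormedModule) _ _ _ HK) => k.
  rewrite /norm /= /abs /= Rabs_pos_eq; last exact: Cmod_ge_0.
  by case: (Hj k) => _ [].
have HKs := Series_correct _ HK.
have HS0 : 0 <= Series K.
  apply: Rle_trans (Cmod_ge_0 (CSeries d)) _.
  by apply: (Cmod_series_le _ _ _ _ HD HKs) => k; case: (Hj k) => _ [].
have Hrem h : Cmod h <= 1 / 4 ->
    Cmod (F (z + h) - F z - CSeries d * h)%C <= Series K * Cmod h ^ 2.
  move=> Hh.
  have HF0 := HF 0%C; rewrite Cmod_0 Cplus_0_r in HF0.
  have {}HF0 := HF0 ltac:(lra).
  have Hdh := is_series_scal_l h _ _ HD.
  have Hs := is_series_minus _ _ _ _ (is_series_minus _ _ _ _ (HF h Hh) HF0) Hdh.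
  have Hb := is_series_scal_l (Cmod h ^ 2 : R_AbsRing) _ _ HKs.
  have := Cmod_series_le _ _ _ _ Hs Hb _.
  rewrite /minus /plus /opp /scal /= /mult /= => H.
  rewrite (Rmult_comm (Series K)) (Cmult_comm _ h).
  apply: H => k; rewrite (Rmult_comm _ (K k)) (Cmult_comm h).
  exact: (proj2 (proj2 (Hj k))).
exists (CSeries d); split; first exact: is_linear_scal_l.
move=> x Hx.
have -> : x = z.
  by apply: esym; apply: is_filter_lim_locally_unique.
move=> eps.
have HS1 : 0 < Series K + 1 by lra.
(* The first bound keeps [h] in the disc of the jets; the second turns the quadratic remainder into
   [eps * Cmod h]. Adding 1 avoids division by 0. *)
have Hdelta : 0 < Rmin (1 / 4) (eps / (Series K + 1)).
  apply: Rmin_pos; first by lra.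
  by apply: Rdiv_lt_0_compat => //; apply: cond_pos.
exists (mkposreal _ Hdelta) => y Hy.
have {}Hy : Cmod (y - z)%C < Rmin (1 / 4) (eps / (Series K + 1)) by exact: Hy.
set h := (y - z)%C in Hy.
have Hh1 := Rlt_le_trans _ _ _ Hy (Rmin_l _ _).
have Hh2 := Rlt_le_trans _ _ _ Hy (Rmin_r _ _).
have := Hrem h ltac:(lra).
have -> : (z + h)%C = y by rewrite /h; ring.
have -> : norm (minus y z) = Cmod h by [].
have -> : norm (minus (minus (F y) (F z)) (scal (minus y z) (CSeries d))) =
  Cmod (F y - F z - CSeries d * h)%C.
  by rewrite (Cmult_comm _ h).
move=> H; apply: Rle_trans H _.
have H0 := Cmod_ge_0 h.
have : (Series K + 1) * Cmod h <= eps.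
  apply: (Rle_trans _ ((Series K + 1) * (eps / (Series K + 1)))).
    by apply: Rmult_le_compat_l; lra.
  by right; field; lra.
by nra.
Qed.

(** * Jets of complex powers and of their differences *)

Lemma jet_bound_le (f : C -> C) (z d : C) (K L : R) :
  K <= L -> jet_bound f z d K -> jet_bound f z d L.
Proof.
move=> HKL [Hf [Hd Hr]]; split; [lra | split; first lra].
by move=> h Hh; have := Hr h Hh; have := Cmod_ge_0 h; nra.
Qed.

Lemma Cexp_linear_remainder (z h : C) (A : R) : 0 <= A -> Cmod h <= 1 / 4 ->
  Cmod (Cexp (- (z + h) * RtoC A) - Cexp (- z * RtoC A)
        - (- RtoC A * Cexp (- z * RtoC A)) * h)%C
  <= exp (- Re z * A) * (5 * A ^ 2 * exp (A / 4)) * Cmod h ^ 2.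
Proof.
move=> HA Hh.
have -> : (- (z + h) * RtoC A = - z * RtoC A + - h * RtoC A)%C by ring.
rewrite Cexp_add; set E := Cexp (- z * _); set u := (- h * RtoC A)%C.
replace (_ - _)%C with (E * (Cexp u - 1 - u))%C by (rewrite /u; ring).
have Hu : Cmod u = A * Cmod h.
  by rewrite Cmod_mult Cmod_opp Cmod_R (Rabs_pos_eq A) // Rmult_comm.
rewrite Cmod_mult Cmod_Cexp Rmult_assoc.
have -> : Re (- z * RtoC A) = - Re z * A by rewrite /Re /=; ring.
apply: Rmult_le_compat_l; first by have := exp_pos (- Re z * A); lra.
apply: Rle_trans (Cexp_sub_1_id_bound u) _.
have : exp (Cmod u) <= exp (A / 4) by apply: exp_le; rewrite Hu; nra.
rewrite Hu => He.
have -> : 5 * (A * Cmod h) ^ 2 * exp (A * Cmod h)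
  = 5 * A ^ 2 * Cmod h ^ 2 * exp (A * Cmod h) by ring.
have := Cmod_ge_0 h => ?.
have : 0 <= 5 * A ^ 2 * Cmod h ^ 2 by nra.
by nra.
Qed.

(** Three factors [exp (A / 4)] arise: from [Re z > - 1/4], from [Cmod h <= 1/4], and from absorbing
    the polynomial in [A]. Their product stays below [exp A], the gain available from a difference
    of powers. *)
Lemma jet_bound_Cexp_large (z : C) (A : R) : 0 <= A -> - (1 / 4) < Re z ->
  jet_bound (fun s => Cexp (- s * RtoC A)) z (- RtoC A * Cexp (- z * RtoC A))%C
    (320 * exp (3 * A / 4)).
Proof.
move=> HA Hz.
have HE : exp (- Re z * A) <= exp (A / 4) by apply: exp_le; nra.
have HE0 := exp_pos (- Re z * A).
have HC : Cmod (Cexp (- z * RtoC A)) = exp (- Re z * A).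
  by rewrite Cmod_Cexp; congr exp; rewrite /Re /=; ring.
have H8 := exp_ineq1_le (A / 8).
have HA4 : exp (A / 4) = exp (A / 8) * exp (A / 8).
  by rewrite -exp_plus; congr exp; field.
have H3A : exp (3 * A / 4) = exp (A / 4) * exp (A / 4) * exp (A / 4).
  by rewrite -!exp_plus; congr exp; field.
(* From [1 + A <= 8 (1 + A / 8) <= 8 exp (A / 8)], squared; then 320 is [5 * 64]. *)
have Hsq : (1 + A) ^ 2 <= 64 * exp (A / 4) by rewrite HA4; nra.
have Hone : 1 <= exp (A / 4) by have := exp_ineq1_le (A / 4); lra.
set e := exp (A / 4) in HE HA4 H3A Hsq Hone.
have Hee : e <= e * e by nra.
have Heee : e * e <= e * e * e by nra.
rewrite H3A; split; last split.
- by rewrite HC; lra.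
- rewrite Cmod_mult Cmod_opp Cmod_R Rabs_pos_eq // HC.
  apply: (Rle_trans _ (64 * e * e)); last by lra.
  by apply: Rmult_le_compat; nra.
move=> h Hh; apply: Rle_trans (Cexp_linear_remainder _ _ _ HA Hh) _.
rewrite -/e; apply: Rmult_le_compat_r; first by have := Cmod_ge_0 h; nra.
have -> : 320 * (e * e * e) = e * (5 * (64 * e) * e) by ring.
apply: Rmult_le_compat; nra.
Qed.

(** What matters is the factor [x] in the bound: subtracting 1 makes the whole jet small with
    [x]. *)
Lemma jet_bound_Cexp_small (z : C) (x : R) : 0 <= x <= 1 ->
  jet_bound (fun s => Cexp (- s * RtoC x) - 1)%C z
    (- RtoC x * Cexp (- z * RtoC x))%C
    (x * (15 * (1 + Cmod z) * exp (2 * Cmod z))).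
Proof.
move=> [Hx0 Hx1]; have Hm := Cmod_ge_0 z.
have HE : exp (- Re z * x) <= exp (2 * Cmod z).
  apply: exp_le.
  by have := re_le_Cmod z; have := Rle_abs (- Re z); rewrite Rabs_Ropp; nra.
have HC : Cmod (Cexp (- z * RtoC x)) = exp (- Re z * x).
  by rewrite Cmod_Cexp; congr exp; rewrite /Re /=; ring.
have HE0 := exp_pos (- Re z * x).
split; last split.
- apply: Rle_trans (Cexp_sub_1_bound _) _.
  rewrite Cmod_mult Cmod_opp Cmod_R (Rabs_pos_eq x) //.
  have HE2 : exp (2 * (Cmod z * x)) <= exp (2 * Cmod z) by apply: exp_le; nra.
  have := exp_pos (2 * (Cmod z * x)).
  have -> : x * (15 * (1 + Cmod z) * exp (2 * Cmod z)) =
    15 * (x * (1 + Cmod z)) * exp (2 * Cmod z) by ring.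
  by move=> ?; apply: Rmult_le_compat; nra.
- rewrite Cmod_mult Cmod_opp Cmod_R Rabs_pos_eq // HC.
  by apply: Rmult_le_compat_l => //; nra.
move=> h Hh.
replace (_ - _)%C with (Cexp (- (z + h) * RtoC x) - Cexp (- z * RtoC x)
        - (- RtoC x * Cexp (- z * RtoC x)) * h)%C by ring.
apply: Rle_trans (Cexp_linear_remainder _ _ _ Hx0 Hh) _.
apply: Rmult_le_compat_r; first by have := Cmod_ge_0 h; nra.
have Hx3 : exp (x / 4) <= 3.
  by apply: Rle_trans _ exp_le_3; apply: exp_le; lra.
have := exp_pos (x / 4) => ?.
apply: (Rle_trans _ (exp (2 * Cmod z) * (x * 15))); last first.
  have : 0 <= x * exp (2 * Cmod z) by nra.
  by nra.
by apply: Rmult_le_compat; nra.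
Qed.

Definition cpow (n : nat) (s : C) : C := Cexp (- s * RtoC (ln (INR n))).

Lemma Cmod_cpow (n : nat) (s : C) : Cmod (cpow n s) = exp (- Re s * ln (INR n)).
Proof. by rewrite Cmod_Cexp; congr exp; rewrite /Re /=; ring. Qed.

(** With [A = ln n] and [x = ln ((n + j) / n) <= j / n], the difference factors as
    [exp (- s A) (exp (- s x) - 1)]. The product of the two jets costs [n^(3/4)] and gains [j / n],
    so a factor [n^(-1/4)] remains; 24000 is [5 * 320 * 15]. *)
Lemma jet_bound_cpow_diff (n j : nat) (z : C) :
  (1 <= n)%nat -> (j <= n)%nat -> - (1 / 4) < Re z ->
  jet_bound (fun s => cpow (n + j) s - cpow n s)%C z
   (- RtoC (ln (INR (n + j))) * cpow (n + j) z + RtoC (ln (INR n)) * cpow n z)%C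
   (24000 * INR j * (1 + Cmod z) * exp (2 * Cmod z) * exp (- ln (INR n) / 4)).
Proof.
move=> Hn Hj Hz.
have HN : 1 <= INR n by apply: (le_INR 1).
have HJ : INR j <= INR n by apply: le_INR.
have HJ0 := pos_INR j.
set A := ln (INR n); set x := ln (INR (n + j)) - A.
have HA : 0 <= A by rewrite -ln_1; apply: ln_le; lra.
have HeA : exp (- A) = / INR n by rewrite exp_Ropp exp_ln //; lra.
have Hx0 : 0 <= x.
  rewrite /x; suff : A <= ln (INR (n + j)) by lra.
  by apply: ln_le; rewrite ?plus_INR; lra.
have HxJ : x <= INR j * exp (- A).
  have -> : x = ln (1 + INR j * exp (- A)).
    rewrite /x /A -ln_div ?plus_INR; try lra.
    by congr ln; rewrite HeA; field; lra.
  rewrite -[X in _ <= X]ln_exp; apply: ln_le; last exact: exp_ineq1_le.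
  by have := exp_pos (- A); nra.
have Hx1 : x <= 1.
  apply: Rle_trans HxJ _; rewrite HeA.
  by apply: (Rmult_le_reg_r (INR n)); [lra | field_simplify; lra].
have := jet_bound_mult _ _ _ _ _ _ _ (jet_bound_Cexp_large z A HA Hz)
  (jet_bound_Cexp_small z x (conj Hx0 Hx1)).
set d := (_ + _)%C => Hjet; set d' := (_ + _)%C.
have -> : d' = d.
  rewrite /d' /d /cpow -/A.
  have -> : ln (INR (n + j)) = A + x by rewrite /x; ring.
  have -> : (- z * RtoC (A + x) = - z * RtoC A + - z * RtoC x)%C.
    by rewrite RtoC_plus; ring.
  by rewrite Cexp_add RtoC_plus; ring.
have Hjet' : jet_bound (fun s => cpow (n + j) s - cpow n s)%C z d
    (5 * (320 * exp (3 * A / 4)) *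
      (x * (15 * (1 + Cmod z) * exp (2 * Cmod z)))).
  have E s : (cpow (n + j) s - cpow n s =
     Cexp (- s * RtoC A) * (Cexp (- s * RtoC x) - 1))%C.
    replace (_ * _)%C with (Cexp (- s * RtoC A) * Cexp (- s * RtoC x)
       - Cexp (- s * RtoC A))%C by ring.
    rewrite -Cexp_add /cpow -/A; congr (Cexp _ - _)%C.
    have -> : ln (INR (n + j)) = A + x by rewrite /x; ring.
    by rewrite RtoC_plus; ring.
  case: Hjet => [H1 [H2 H3]]; split; [|split] => //; first by rewrite E.
  by move=> h Hh; rewrite !E; apply: H3.
apply: jet_bound_le Hjet'.
have HeA4 : exp (- A / 4) = exp (3 * A / 4) * exp (- A).
  by rewrite -exp_plus; congr exp; field.
rewrite HeA4.
have Hm := Cmod_ge_0 z.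
set q := (1 + Cmod z) * exp (2 * Cmod z).
have Hq : 0 <= q * exp (3 * A / 4).
  apply: Rmult_le_pos; last by left; apply: exp_pos.
  by apply: Rmult_le_pos; [lra | left; apply: exp_pos].
rewrite /q in Hq; nra.
Qed.

(** * Series over dyadic blocks *)

(** For [e k <= n < e (k + 1)] the partial sum of [b] up to [n] equals that of the subsequence up to
    [k]. *)
Lemma is_series_sparse {K : AbsRing} {V : NormedModule K} (b : nat -> V)
    (e : nat -> nat) (l : V) :
  (forall k, (e k < e (S k))%nat) ->
  (forall n, (forall k, n <> e k) -> b n = zero) ->
  is_series (fun k => b (e k)) l -> is_series b l.
Proof.
move=> He Hb Hl.
have Hmono k i : (k < i)%nat -> (e k < e i)%nat.
  by elim: i => [|i IH] Hi; [lia | have := He i; case: (Nat.eq_dec k i) => [->|]; lia].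
have Hinj k i : (e k < e i)%nat -> (k < i)%nat.
  move=> H; case: (Nat.lt_ge_cases k i) => // Hi.
  by case: (Nat.eq_dec i k) H => [->|Hn]; [lia | have := Hmono i k; lia].
have Hlow n : (n < e 0)%nat -> sum_n b n = zero.
  have Hz m : (m < e 0)%nat -> b m = zero.
    by move=> Hm; apply: Hb => k; case: k => [|k]; [lia | have := Hmono 0%nat (S k); lia].
  elim: n => [|n IH] Hn; first by rewrite sum_O Hz.
  by rewrite sum_Sn IH ?Hz ?plus_zero_r //; lia.
have Hsum n : forall k, (e k <= n < e (S k))%nat ->
    sum_n b n = sum_n (fun k => b (e k)) k.
  elim: n => [|n IH] k Hk.
    have Hk0 : k = 0%nat by case: k Hk => // k; have := Hmono 0%nat (S k); lia.
    by subst k; rewrite !sum_O; congr b; lia.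
  case: (Nat.eq_dec (e k) (S n)) => Hek; last first.
    rewrite sum_Sn (IH k) ?(Hb (S n)) ?plus_zero_r //; last lia.
    move=> i Hi; have := Hinj k i; have := Hinj i (S k); lia.
  case: k Hk Hek => [|k] Hk Hek.
    by rewrite sum_Sn Hlow ?sum_O ?plus_zero_l ?Hek //; lia.
  by rewrite !sum_Sn Hek (IH k) //; have := He k; lia.
have Hex m n : (e m <= n)%nat -> exists k, (m <= k)%nat /\ (e k <= n < e (S k))%nat.
  elim: n => [|n IH] Hn; first by exists m; have := He m; lia.
  case: (Nat.eq_dec (e m) (S n)) => Hem; first by exists m; have := He m; lia.
  have [k [Hk1 Hk2]] := IH ltac:(lia).
  case: (Nat.eq_dec (e (S k)) (S n)) => HeS.
    by exists (S k); have := He (S k); lia.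
  by exists k; lia.
apply/filterlim_locally => eps.
have [m Hm] := proj1 (filterlim_locally _ _) Hl eps.
exists (e m) => n Hn.
by have [k [Hk1 Hk2]] := Hex m n Hn; rewrite (Hsum n k Hk2); apply: Hm.
Qed.

(* [n] minus the largest [P 2^k <= n]; by truncation it is 0 for [n < P]. *)
Definition offset (P n : nat) : nat := (n - P * 2 ^ Nat.log2 (n / P))%nat.

Lemma offset_small (P n : nat) : (n < P)%nat -> offset P n = 0%nat.
Proof. by move=> H; rewrite /offset Nat.div_small //=; lia. Qed.

Lemma offset_add (P k j : nat) : (j < P)%nat -> offset P (P * 2 ^ k + j) = j.
Proof.
move=> H; rewrite /offset Nat.mul_comm Nat.div_add_l; last lia.
by rewrite (Nat.div_small j) // Nat.add_0_r Nat.log2_pow2; lia.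
Qed.

Lemma offset_large (P n : nat) : (1 <= P)%nat -> (P <= n)%nat ->
  n = (P * 2 ^ Nat.log2 (n / P) + offset P n)%nat.
Proof.
move=> HP Hn; rewrite /offset.
have H1 : (1 <= n / P)%nat by apply: Nat.div_le_lower_bound; lia.
have [H2 _] := Nat.log2_spec (n / P) ltac:(lia).
have := Nat.Div0.mul_div_le n P.
have := Nat.mul_le_mono_l _ _ P H2.
lia.
Qed.

(** The terms of one fixed offset form a sparse series, and the whole series is a finite sum of
    these. *)
Lemma is_series_by_offset {K : AbsRing} {V : NormedModule K} (P J : nat)
    (t : nat -> V) (l : nat -> V) :
  (J < P)%nat ->
  (forall n, offset P n = 0%nat -> t n = zero) ->
  (forall n, (J < offset P n)%nat -> t n = zero) ->
  (forall j, (j <= J)%nat -> is_series (fun k => t (P * 2 ^ k + j)%nat) (l j)) ->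
  is_series (fun n => t (S n)) (sum_n l J).
Proof.
move=> HJP H0 HJ Hl.
have Hpow k : (1 <= 2 ^ k)%nat by have := Nat.pow_nonzero 2 k; lia.
have spike j : (j <= J)%nat -> is_series
    (fun n => if Nat.eqb (offset P (S n)) j then t (S n) else zero) (l j).
  move=> Hj; apply: (is_series_sparse _ (fun k => Nat.pred (P * 2 ^ k + j))).
  - by move=> k; rewrite Nat.pow_succ_r'; have := Hpow k; nia.
  - move=> n Hn; case: Nat.eqb_spec => // Hoff.
    (* Offset 0 is also the value at every [n < P], so here the support condition comes from the
       vanishing of [t] at offset 0. *)
    case: (Nat.eq_dec j 0) => [Hj0|Hj0]; first by apply: H0; lia.
    case: (Nat.lt_ge_cases (S n) P) => HnP.
      by rewrite offset_small in Hoff; lia.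
    have := offset_large P (S n) ltac:(lia) HnP.
    by have := Hn (Nat.log2 (S n / P)); lia.
  - apply: is_series_ext (Hl j Hj) => k.
    have -> : S (Nat.pred (P * 2 ^ k + j)) = (P * 2 ^ k + j)%nat.
      by have := Hpow k; nia.
    by rewrite offset_add ?Nat.eqb_refl //; lia.
have partial I : (I <= J)%nat -> is_series
    (fun n => if Nat.leb (offset P (S n)) I then t (S n) else zero) (sum_n l I).
  elim: I => [|I IH] HI.
    rewrite sum_O; apply: is_series_ext (spike 0%nat HI) => n.
    by case: (offset P (S n)).
  rewrite sum_Sn.
  apply: is_series_ext (is_series_plus _ _ _ _ (IH ltac:(lia)) (spike _ HI)) => n.
  case: (Nat.leb_spec _ I); case: (Nat.leb_spec _ (S I)); case: Nat.eqb_spec => *;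
    by [lia | rewrite plus_zero_l | rewrite plus_zero_r].
apply: is_series_ext (partial J (le_n J)) => n.
by case: (Nat.leb_spec _ J) => // H; rewrite HJ.
Qed.

Lemma ln_dyadic (P k : nat) : (1 <= P)%nat ->
  ln (INR (P * 2 ^ k)) = ln (INR P) + INR k * ln 2.
Proof.
move=> HP; rewrite mult_INR pow_INR (_ : INR 2 = 2) //.
have HP' : 0 < INR P by apply: lt_0_INR.
have H2 : 0 < 2 ^ k by apply: pow_lt; lra.
by rewrite ln_mult // ln_pow //; lra.
Qed.

(** A geometric series of ratio [2^(-x)]. *)
Lemma ex_series_dyadic (P : nat) (x : R) : (1 <= P)%nat -> 0 < x ->
  ex_series (fun k => exp (- x * ln (INR (P * 2 ^ k)))).
Proof.
move=> HP Hx.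
have Hln2 : 0 < ln 2 by rewrite -ln_1; apply: ln_increasing; lra.
apply: (ex_series_ext (fun k => exp (- x * ln (INR P)) * exp (- x * ln 2) ^ k)).
  move=> k; rewrite ln_dyadic // Rmult_plus_distr_l exp_plus; congr (_ * _).
  elim: k => [|k IH]; first by rewrite /= Rmult_0_l Rmult_0_r exp_0.
  by rewrite S_INR -tech_pow_Rmult IH -exp_plus; congr exp; ring.
apply: (@ex_series_scal R_AbsRing R_NormedModule); apply: ex_series_geom.
rewrite Rabs_pos_eq; last by left; apply: exp_pos.
by rewrite -exp_0; apply: exp_increasing; nra.
Qed.

Definition dyadic_diff_series (P j : nat) (s : C) : C :=
  CSeries (fun k => cpow (P * 2 ^ k + j) s - cpow (P * 2 ^ k) s)%C.

Lemma dyadic_diff_jets (P j : nat) (z : C) : (j < P)%nat -> - (1 / 4) < Re z ->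
  exists (d : nat -> C) (K : nat -> R), ex_series K /\
    forall k, jet_bound
      (fun s => cpow (P * 2 ^ k + j) s - cpow (P * 2 ^ k) s)%C z (d k) (K k).
Proof.
move=> HjP Hz.
have Hpow k : (1 <= 2 ^ k)%nat by have := Nat.pow_nonzero 2 k; lia.
have Hj k := jet_bound_cpow_diff (P * 2 ^ k) j z
  ltac:(have := Hpow k; nia) ltac:(have := Hpow k; nia) Hz.
eexists; eexists; split; last exact: Hj.
apply: (@ex_series_scal R_AbsRing R_NormedModule).
apply: ex_series_ext (ex_series_dyadic P (1 / 4) ltac:(lia) ltac:(lra)) => k.
by congr exp; field.
Qed.

Lemma dyadic_diff_series_correct (P j : nat) (z : C) :
  (j < P)%nat -> - (1 / 4) < Re z ->
  is_Cseries (fun k => cpow (P * 2 ^ k + j) z - cpow (P * 2 ^ k) z)%C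
    (dyadic_diff_series P j z).
Proof.
move=> HjP Hz; have [d [K [HK Hjet]]] := dyadic_diff_jets P j z HjP Hz.
apply: CSeries_correct.
apply: (ex_series_le (V := R_CompleteNormedModule) _ _ _ HK) => k.
rewrite /norm /= /abs /= Rabs_pos_eq; last exact: Cmod_ge_0.
by case: (Hjet k).
Qed.

Lemma ex_derive_dyadic_diff_series (P j : nat) (z : C) :
  (j < P)%nat -> - (1 / 4) < Re z ->
  @ex_derive C_AbsRing C_NormedModule (dyadic_diff_series P j) z.
Proof.
move=> HjP Hz; have [d [K [HK Hjet]]] := dyadic_diff_jets P j z HjP Hz.
exact: ex_derive_series HK Hjet.
Qed.

Lemma Cmod_cpow_add_le (n j : nat) (s : C) : (1 <= n)%nat -> 0 < Re s ->
  Cmod (cpow (n + j) s) <= exp (- Re s * ln (INR n)).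
Proof.
move=> Hn Hs; rewrite Cmod_cpow; apply: exp_le.
suff : ln (INR n) <= ln (INR (n + j)) by nra.
by apply: ln_le; [apply: lt_0_INR | apply: le_INR]; lia.
Qed.

(** * Dirichlet series whose coefficients depend only on the offset *)

Section DyadicDirichlet.

Variables (P J : nat) (c : nat -> C).
Hypothesis HJP : (J < P)%nat.
(** Offset 0 occurs at all [n < P] as well as at the points [P 2^k]; this makes the coefficients
    vanish there. *)
Hypothesis c0 : c 0%nat = 0.
Hypothesis c_big : forall j, (J < j)%nat -> c j = 0.
Hypothesis c_sum : sum_n c J = RtoC 0.

Let a (n : nat) : C := c (offset P n).

Let dyadic_pos k : (1 <= P * 2 ^ k)%nat.
Proof. by have := Nat.pow_nonzero 2 k; nia. Qed.

Lemma dyadic_dirichlet_abs_cv (s : C) : 0 < Re s -> dirichlet_abs_cv a s.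
Proof.
move=> Hs.
have Hj j : ex_series (fun k => Cmod (c j * cpow (P * 2 ^ k + j) s)%C).
  apply: (ex_series_le (V := R_CompleteNormedModule) _
    (fun k => Cmod (c j) * exp (- Re s * ln (INR (P * 2 ^ k))))).
    move=> k; rewrite /norm /= /abs /= Rabs_pos_eq; last exact: Cmod_ge_0.
    rewrite Cmod_mult; apply: Rmult_le_compat_l; first exact: Cmod_ge_0.
    exact: Cmod_cpow_add_le.
  apply: (@ex_series_scal R_AbsRing R_NormedModule).
  by apply: ex_series_dyadic; lia || lra.
eexists.
apply: (is_series_by_offset (V := R_NormedModule) P J
  (fun n => Cmod (dirichlet_term a s n)) _ HJP).
- by move=> n Hn; rewrite /dirichlet_term /a Hn c0 Cmult_0_l Cmod_0.
- by move=> n Hn; rewrite /dirichlet_term /a c_big // Cmult_0_l Cmod_0.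
- move=> j HjJ; apply: is_series_ext (Series_correct _ (Hj j)) => k.
  by rewrite /dirichlet_term /a offset_add //; lia.
Qed.

Lemma dyadic_dirichlet_not_abs_cv (j : nat) (s : C) :
  c j <> 0 -> Re s <= 0 -> ~ dirichlet_abs_cv a s.
Proof.
move=> Hj Hs Hcv.
have HjJ : (j <= J)%nat.
  by case: (Nat.lt_ge_cases J j) => // H; case: Hj; apply: c_big.
have Hpos : 0 < Cmod (c j) by apply/Cmod_gt_0.
(* The terms would eventually drop below [Cmod (c j)]. The threshold [m] also serves as the
   exponent: [m < 2^m] puts the point [P 2^m + j] beyond it, yet the term there has modulus at least
   [Cmod (c j)]. *)
have [m Hm] := proj1 (filterlim_locally _ _) (ex_series_lim_0 _ Hcv)
  (mkposreal _ Hpos).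
have Hpow : (m < 2 ^ m)%nat by apply: Nat.pow_gt_lin_r; lia.
have := Hm (Nat.pred (P * 2 ^ m + j)) ltac:(nia).
have -> : S (Nat.pred (P * 2 ^ m + j)) = (P * 2 ^ m + j)%nat by nia.
rewrite /ball /= /AbsRing_ball /= /abs /minus /plus /opp /= Ropp_0 Rplus_0_r.
rewrite Rabs_pos_eq; last exact: Cmod_ge_0.
rewrite /dirichlet_term /a offset_add; last by lia.
rewrite Cmod_mult -/(cpow _ s) Cmod_cpow.
have Hln : 0 <= ln (INR (P * 2 ^ m + j)).
  rewrite -ln_1; apply: ln_le; first by lra.
  by apply: (le_INR 1); nia.
have := exp_ineq1_le (- Re s * ln (INR (P * 2 ^ m + j))).
have : 0 <= - Re s * ln (INR (P * 2 ^ m + j)) by nra.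
by move=> /= H1 H2 H3; nra.
Qed.

Lemma dyadic_dirichlet_abscissa (j : nat) : c j <> 0 -> abscissa_abs_cv a = Finite 0.
Proof.
move=> Hj; apply: is_glb_Rbar_unique; split.
- move=> x Hx /=; case: (Rle_lt_dec 0 x) => // Hx0; exfalso.
  (* For [x < 0] the point [x / 2] lies strictly between [x] and 0. *)
  apply: (dyadic_dirichlet_not_abs_cv j (RtoC (x / 2)) Hj _ (Hx _ _));
    rewrite /Re /=; lra.
- move=> b Hb; apply: (Hb 0) => s Hs; exact: dyadic_dirichlet_abs_cv.
Qed.

(* As [c] sums to 0 over a dyadic block, [(P 2^k)^(-s)] may be subtracted from
   every term of the block, which makes the series converge to the left of 0. *)
Let F (s : C) : C := sum_n (fun j => c j * dyadic_diff_series P j s)%C J.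

Lemma dyadic_dirichlet_sum (s : C) : 0 < Re s -> is_dirichlet_sum a s (F s).
Proof.
move=> Hs.
have HZ : is_Cseries (fun k => cpow (P * 2 ^ k) s)
    (CSeries (fun k => cpow (P * 2 ^ k) s)).
  apply: CSeries_correct; apply: ex_series_ext (ex_series_dyadic P (Re s) _ Hs).
    by move=> k; rewrite Cmod_cpow.
  by lia.
set Z := CSeries _ in HZ.
(* Since [c] sums to 0, the subtracted powers, whose sum [Z] converges for [Re s > 0], can be put
   back; then each offset is summed separately. *)
have -> : F s = sum_n (fun j => c j * (Z + dyadic_diff_series P j s))%C J.
  have -> : F s = (sum_n c J * Z + F s)%C by rewrite c_sum; ring.
  rewrite /F; elim: (J) => [|i IH]; first by rewrite !sum_O; ring.
  rewrite !sum_Sn -IH /plus /=; ring.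
apply: (is_series_by_offset (V := C_NormedModule) P J
  (dirichlet_term a s) _ HJP).
- by move=> n Hn; rewrite /dirichlet_term /a Hn c0 Cmult_0_l.
- by move=> n Hn; rewrite /dirichlet_term /a c_big // Cmult_0_l.
- move=> j HjJ.
  have HG := dyadic_diff_series_correct P j s ltac:(lia) ltac:(lra).
  apply: is_series_ext (is_series_scal (c j) _ _ (is_series_plus _ _ _ _ HZ HG)) => k.
  rewrite /dirichlet_term /a offset_add -/(cpow _ s); last by lia.
  by rewrite /scal /plus /= /mult /=; ring.
Qed.

Lemma ex_derive_dyadic_sum (s : C) : - (1 / 4) < Re s ->
  @ex_derive C_AbsRing C_NormedModule F s.
Proof.
move=> Hs.
have H i : (i <= J)%nat -> @ex_derive C_AbsRing C_NormedModule
    (fun s => sum_n (fun j => c j * dyadic_diff_series P j s)%C i) s.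
  have Hj j : (j <= J)%nat -> @ex_derive C_AbsRing C_NormedModule
      (fun s => c j * dyadic_diff_series P j s)%C s.
    move=> HjJ; have [d Hd] := ex_derive_dyadic_diff_series P j s ltac:(lia) Hs.
    exists (c j * d)%C.
    have Hcd := filterdiff_scal_r_fct (c j) _ _ Cmult_comm Hd.
    apply: (filterdiff_ext_lin _ _ _ (Hcd _)) => y.
    by rewrite /scal /= /mult /=; ring.
  elim: i => [|i IH] HiJ.
    by apply: ex_derive_ext (Hj 0%nat HiJ) => t; rewrite sum_O.
  apply: ex_derive_ext (ex_derive_plus _ _ _ (IH ltac:(lia)) (Hj _ HiJ)) => t.
  by rewrite sum_Sn.
exact: H.
Qed.

Lemma dyadic_dirichlet_extension : has_holomorphic_extension_past_0 a.
Proof.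
(* The disc of radius 1/4 lies in the half-plane [Re s > - 1/4] where [F] is differentiable. *)
exists (1 / 4), F; split; first by lra.
split; last exact: dyadic_dirichlet_sum.
move=> z Hz; apply: ex_derive_dyadic_sum.
case: Hz => Hz; first by lra.
by have := re_le_Cmod z; have := Rle_abs (- Re z); rewrite Rabs_Ropp; lra.
Qed.

End DyadicDirichlet.

(** * The coefficients and the cone conditions *)

Lemma Cexp_Ci (x : R) : Cexp (Ci * RtoC x) = (cos x, sin x).
Proof.
have -> : (Ci * RtoC x)%C = (0, x) by apply: injective_projections => /=; ring.
by rewrite /Cexp /Re /Im /= exp_0 !Rmult_1_l.
Qed.

(** For [D >= 2] the offsets [D - 1], [D], [2 D - 1] and [2 D] are distinct and nonzero. Testing
    [S j] instead of [j] avoids truncated subtraction. *)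
Definition pattern_mod (D : nat) (r : R) (j : nat) : R :=
  if Nat.eqb j D then 1 else if Nat.eqb j (2 * D) then 1
  else if Nat.eqb (S j) D then r else if Nat.eqb (S j) (2 * D) then r else 0.

Definition pattern_arg (D : nat) (phi psi : R) (j : nat) : R :=
  if Nat.eqb j D then phi else if Nat.eqb j (2 * D) then - phi
  else if Nat.eqb (S j) D then psi else if Nat.eqb (S j) (2 * D) then - psi else 0.

Lemma sum_n_single (m n : nat) (u : C) :
  sum_n (fun j => if Nat.eqb j m then u else RtoC 0) n =
  if Nat.leb m n then u else RtoC 0.
Proof.
elim: n => [|n IH]; first by rewrite sum_O; case: m.
rewrite sum_Sn IH.
by case: (Nat.eqb_spec (S n) m) => ?; case: (Nat.leb_spec m n) => ?;
  case: (Nat.leb_spec m (S n)) => ?; try lia; rewrite /plus /=; ring.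
Qed.

Section Pattern.

Variables (D : nat) (r phi psi : R).
Hypotheses (HD : (2 <= D)%nat) (Hr : 0 <= r).
Hypothesis Hcos : cos phi + r * cos psi = 0.

Let c (j : nat) : C :=
  (RtoC (pattern_mod D r j) * Cexp (Ci * RtoC (pattern_arg D phi psi j)))%C.

Lemma pattern_mod_ge_0 (j : nat) : 0 <= pattern_mod D r j.
Proof. by rewrite /pattern_mod; repeat case: Nat.eqb_spec => _; lra. Qed.

(** Conjugate pairs cancel the imaginary parts, and the real parts add up to
    [2 (cos phi + r cos psi)]. *)
Lemma pattern_sum : sum_n c (2 * D) = RtoC 0.
Proof.
pose e := Cexp (Ci * RtoC phi); pose e' := Cexp (Ci * RtoC (- phi)).
pose f := (RtoC r * Cexp (Ci * RtoC psi))%C.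
pose f' := (RtoC r * Cexp (Ci * RtoC (- psi)))%C.
pose ind m (u : C) j := if Nat.eqb j m then u else RtoC 0.
rewrite (sum_n_ext _ (fun j => plus (plus (ind D e j) (ind (2 * D)%nat e' j))
  (plus (ind (D - 1)%nat f j) (ind (2 * D - 1)%nat f' j)))).
  rewrite !sum_n_plus !sum_n_single.
  do 4 (case: Nat.leb_spec; first [by lia | move=> _]).
  rewrite /e /e' /f /f' !Cexp_Ci !cos_neg !sin_neg /plus /=.
  by apply: injective_projections => /=; lra.
move=> j; rewrite /ind /c /pattern_mod /pattern_arg.
by case: (Nat.eqb_spec j D) => ?; case: (Nat.eqb_spec j (2 * D)) => ?;
  case: (Nat.eqb_spec (S j) D) => ?; case: (Nat.eqb_spec (S j) (2 * D)) => ?;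
  case: (Nat.eqb_spec j (D - 1)) => ?; case: (Nat.eqb_spec j (2 * D - 1)) => ?;
  try lia; rewrite /e /e' /f /f' /plus /=; ring.
Qed.

Lemma pattern_dirichlet :
  let a n := c (offset (4 * D) n) in
  abscissa_abs_cv a = Finite 0 /\ has_holomorphic_extension_past_0 a.
Proof.
have HJP : (2 * D < 4 * D)%nat by lia.
have c0 : c 0%nat = RtoC 0.
  by rewrite /c /pattern_mod; repeat case: Nat.eqb_spec => ?; try lia; ring.
have cbig j : (2 * D < j)%nat -> c j = RtoC 0.
  by move=> Hj; rewrite /c /pattern_mod; repeat case: Nat.eqb_spec => ?; try lia; ring.
split.
  apply: (dyadic_dirichlet_abscissa (4 * D) (2 * D) c HJP c0 cbig D).
  rewrite /c /pattern_mod Nat.eqb_refl => H.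
  have := f_equal Cmod H.
  rewrite Cmod_mult Cmod_Cexp Cmod_1 Cmod_0.
  by have := exp_pos (Re (Ci * RtoC (pattern_arg D phi psi D))); lra.
exact: (dyadic_dirichlet_extension (4 * D) (2 * D) c HJP c0 cbig pattern_sum).
Qed.

Lemma pattern_Cmod (j : nat) : Cmod (c j) = pattern_mod D r j.
Proof.
rewrite /c Cmod_mult Cmod_Cexp Cmod_R Rabs_pos_eq; last exact: pattern_mod_ge_0.
have -> : Re (Ci * RtoC (pattern_arg D phi psi j)) = 0 by rewrite /Re /=; ring.
by rewrite exp_0 Rmult_1_r.
Qed.

Lemma pattern_arguments :
  has_arguments (fun n => c (offset (4 * D) n))
    (fun n => pattern_arg D phi psi (offset (4 * D) n)).
Proof. by move=> n _; rewrite pattern_Cmod. Qed.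

End Pattern.

(** * Positions within blocks and the polar conditions *)

Lemma cos_pattern_arg (D : nat) (phi psi : R) (j : nat) :
  cos (pattern_arg D phi psi j) =
  if Nat.eqb j D || Nat.eqb j (2 * D) then cos phi
  else if Nat.eqb (S j) D || Nat.eqb (S j) (2 * D) then cos psi else 1.
Proof.
rewrite /pattern_arg.
by case: (Nat.eqb j D); case: (Nat.eqb j (2 * D)); case: (Nat.eqb (S j) D);
  case: (Nat.eqb (S j) (2 * D)); rewrite ?cos_neg ?cos_0.
Qed.

Lemma ord_lt (M : nat) (i : 'I_M) : (i < M)%nat.
Proof. exact: (elimT ssrnat.ltP (ltn_ord i)). Qed.

(** As [M] divides [D], it divides every [4 D 2^k]. So a positive offset divisible by [M] belongs to
    an index divisible by [M], which ends its block. This confines the offsets [D] and [2 D] to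
    block ends. *)
Lemma offset_block_end (M D q l i : nat) :
  (i < M)%nat -> (1 <= D)%nat -> D = (q * M)%nat ->
  forall m, offset (4 * D) (M * l + S i) = (m * M)%nat -> (0 < m)%nat -> S i = M.
Proof.
move=> Hi HD0 HD m Hoff Hm.
have HmM : (0 < m * M)%nat by apply: Nat.mul_pos_pos; lia.
case: (Nat.lt_ge_cases (M * l + S i) (4 * D)) => Hlt.
  by rewrite offset_small in Hoff; lia.
have := offset_large (4 * D) (M * l + S i) ltac:(lia) Hlt.
rewrite Hoff; set k := (2 ^ _)%nat => H; rewrite HD in H.
set t := (4 * q * k + m)%nat.
have {}H : (M * l + S i = M * t)%nat by rewrite H /t; ring.
have Hlt' : (l < t)%nat.
  by apply/Nat.nle_gt => Ht; have := Nat.mul_le_mono_l _ _ M Ht; lia.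
by have := Nat.mul_le_mono_l _ _ M Hlt'; rewrite Nat.mul_succ_r; lia.
Qed.

Lemma offset_S (P n : nat) : (0 < offset P n)%nat -> (S (offset P n) < P)%nat ->
  offset P (S n) = S (offset P n).
Proof.
move=> H0 H1.
case: (Nat.lt_ge_cases n P) => Hn; first by rewrite offset_small in H0; lia.
have E := offset_large P n ltac:(lia) Hn.
by rewrite {1}E -Nat.add_succ_r offset_add.
Qed.

Lemma sum_ord_le_0 (M : nat) (F : 'I_M -> R) :
  (forall i, F i <= 0) -> \big[Rplus/0]_(i < M) F i <= 0.
Proof.
move=> H; apply: (big_ind (fun x => x <= 0)) => //; [lra | by move=> x y; lra].
Qed.

(** Fits the inner products of part (II), where a negative cosine occurs only next to last in a
    block and is compensated by the last entry. *)
Lemma sum_ord_le_0_last2 (m : nat) (F : 'I_(S (S m)) -> R) :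
  (forall i : 'I_(S (S m)), (i < m)%nat -> F i <= 0) ->
  (forall i j : 'I_(S (S m)), nat_of_ord i = m -> nat_of_ord j = S m -> F i + F j <= 0) ->
  \big[Rplus/0]_(i < S (S m)) F i <= 0.
Proof.
elim: m F => [|m IH] F H1 H2.
  rewrite !big_ord_recl big_ord0.
  by have := H2 ord0 (lift ord0 ord0) erefl erefl; lra.
rewrite big_ord_recl.
have := H1 ord0 ltac:(simpl; lia).
have : \big[Rplus/0]_(i < S (S m)) F (lift ord0 i) <= 0.
  apply: IH => [i Hi | i j Hi Hj].
    by apply: H1; rewrite lift0; lia.
  by apply: H2; rewrite lift0 ?Hi ?Hj.
lra.
Qed.

Lemma pattern_same_cone (M : nat) (rho : R) : (1 <= M)%nat -> 0 < rho ->
  exists (a : nat -> C) (theta : nat -> R),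
    has_arguments a theta /\
    abscissa_abs_cv a = Finite 0 /\
    (forall l, Bcone M rho (block M (fun n => Cmod (a n)) l)) /\
    (forall l, opp_set M (polar M (Bcone M rho))
       (block M (fun n => cos (theta n)) l)) /\
    has_holomorphic_extension_past_0 a.
Proof.
(* The factor 2 ensures [D >= 2] even for [M = 1]. *)
move=> HM Hrho; pose D := (2 * M)%nat.
have HD : (2 <= D)%nat by rewrite /D; lia.
have Hcos : cos (PI / 2) + 0 * cos (PI / 2) = 0 by rewrite cos_PI2; ring.
have [Habs Hext] := pattern_dirichlet D 0 (PI / 2) (PI / 2) HD Hcos.
eexists; eexists; split.
  by apply: (pattern_arguments D 0 (PI / 2) (PI / 2)); lra.
split; first exact: Habs.
split; last split; last exact: Hext.
- move=> l; split=> [i|i j Hij].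
    exact: Cmod_ge_0.
  have Hj := ord_lt _ j.
  rewrite /block pattern_Cmod ?pattern_Cmod; try lra.
  (* Entry [i] has a successor in its block, while nonzero moduli occur only at block ends. *)
  have -> : pattern_mod D 0 (offset (4 * D) (M * l + S i)) = 0.
    rewrite /pattern_mod.
    have Hend := offset_block_end M D 2 l i ltac:(lia) ltac:(lia) erefl.
    case: Nat.eqb_spec => H1; first by have := Hend 2%nat H1; lia.
    case: Nat.eqb_spec => H2; first by have := Hend 4%nat; rewrite H2 /D; lia.
    by case: ifP => // _; case: ifP.
  rewrite Rmult_0_r; apply: Rmult_le_pos; first by apply: pow_le; lra.
  by apply: pattern_mod_ge_0; lra.
- move=> l; eexists; split; last by move=> i; rewrite -[LHS]Ropp_involutive.
  (* All cosines are 0 or 1 and all entries of [b] are nonnegative, so the estimate holds term by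
     term. *)
  move=> b [Hb _]; apply: sum_ord_le_0 => i.
  have := Hb i; rewrite /block cos_pattern_arg cos_PI2.
  by case: orb; [|case: orb]; lra.
Qed.

Lemma pattern_smaller_cone (M : nat) (rho' rho : R) :
  (2 <= M)%nat -> 0 < rho' -> rho' < rho ->
  exists (gamma : R) (a : nat -> C) (theta : nat -> R),
    0 < gamma /\
    has_arguments a theta /\
    abscissa_abs_cv a = Finite 0 /\
    (forall l, Bcone M rho (block M (fun n => Cmod (a n)) l)) /\
    (forall l, translate_set M (opp_set M (polar M (Bcone M rho')))
       (fun _ => gamma) (block M (fun n => cos (theta n)) l)) /\
    has_holomorphic_extension_past_0 a.
Proof.
move=> HM Hrho' Hrho.
(* This choice makes both [c] and [c / rho] at most 1, so that both are available as absolute values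
   of cosines. *)
pose c := Rmin 1 rho.
have Hc0 : 0 < c by apply: Rmin_pos; lra.
have Hc1 : c <= 1 by apply: Rmin_l.
have Hcr : c <= rho by apply: Rmin_r.
pose d := c / rho.
have Hdr : d * rho = c by rewrite /d; field; lra.
have Hd0 : 0 < d by apply: Rdiv_lt_0_compat; lra.
have Hd1 : d <= 1 by nra.
(* The solution of [(d + gamma) rho' = c - gamma], the balance between the last two entries when
   [b_(M-1) = rho' b_M]. It is positive because [d rho' < d rho = c]. *)
pose gamma := (c - d * rho') / (1 + rho').
have Hg : gamma * (1 + rho') = c - d * rho' by rewrite /gamma; field; lra.
have Hg0 : 0 < gamma by apply: Rdiv_lt_0_compat; nra.
have Hgc : gamma <= c by nra.
pose phi := acos c; pose psi := acos (- d).
have Hphi : cos phi = c by apply: cos_acos; lra.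
have Hpsi : cos psi = - d by apply: cos_acos; lra.
have Hcos : cos phi + rho * cos psi = 0 by rewrite Hphi Hpsi; lra.
have [Habs Hext] := pattern_dirichlet M rho phi psi HM Hcos.
exists gamma; eexists; eexists; split; first exact: Hg0.
split; first by apply: (pattern_arguments M rho phi psi); lra.
split; first exact: Habs.
have Hend l i (Hi : (i < M)%nat) :=
  offset_block_end M M 1 l i Hi ltac:(lia) (esym (Nat.mul_1_l M)).
split; last split; last exact: Hext.
- move=> l; split=> [i|i j Hij].
    exact: Cmod_ge_0.
  have Hj := ord_lt _ j.
  rewrite /block pattern_Cmod ?pattern_Cmod; try lra.
  have Hi := Hend l i ltac:(lia).
  rewrite Hij; set n := (M * l + S i)%nat.
  have -> : (M * l + S (S i))%nat = S n by rewrite /n; lia.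
  have Hrho0 : 0 < rho ^ i by apply: pow_lt; lra.
  have Hge0 : 0 <= rho ^ S i * pattern_mod M rho (offset (4 * M) (S n)).
    by apply: Rmult_le_pos; [apply: pow_le; lra | apply: pattern_mod_ge_0; lra].
  rewrite {1}/pattern_mod.
  case: Nat.eqb_spec => H1; first by have := Hi 1%nat; rewrite -/n H1; lia.
  case: Nat.eqb_spec => H2; first by have := Hi 2%nat; rewrite -/n H2; lia.
  (* Offset [M - 1] has modulus [rho] and is followed by modulus 1, so the chain holds with
     equality; offset [2 M - 1] is alike. *)
  case: Nat.eqb_spec => H3.
    rewrite offset_S ?H3 /pattern_mod ?Nat.eqb_refl; try lia.
    by rewrite /=; lra.
  case: Nat.eqb_spec => H4; last by lra.
  rewrite offset_S ?H4 /pattern_mod ?Nat.eqb_refl; try lia.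
  by case: Nat.eqb_spec => _ /=; lra.
- move=> l.
  exists (fun i =>
    block M (fun n => cos (pattern_arg M phi psi (offset (4 * M) n))) l i - gamma).
  split; last by move=> i; ring.
  eexists; split; last by move=> i; rewrite -[LHS]Ropp_involutive.
  have Hcos0 i : (S i < M)%nat ->
      let o := offset (4 * M) (M * l + S i) in
      (Nat.eqb o M || Nat.eqb o (2 * M)) = false.
    move=> Hi o; have He := Hend l i ltac:(lia).
    apply/negP => /orP [] /Nat.eqb_eq H.
      by have := He 1%nat; rewrite -/o H; lia.
    by have := He 2%nat; rewrite -/o H; lia.
  have Hcos1 i : (S (S i) < M)%nat ->
      let o := offset (4 * M) (M * l + S i) in
      (Nat.eqb (S o) M || Nat.eqb (S o) (2 * M)) = false.
    move=> Hi o; have := Hcos0 (S i) Hi.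
    rewrite Nat.add_succ_r; case: (Nat.lt_ge_cases 0 o) => Ho; last first.
      move=> _; apply/negP => /orP [] /Nat.eqb_eq H; lia.
    case: (Nat.lt_ge_cases (S o) (4 * M)) => Ho'; first by rewrite offset_S.
    by move=> _; apply/negP => /orP [] /Nat.eqb_eq H; lia.
  have Hlast i : S i = M ->
      let o := offset (4 * M) (M * l + S i) in
      gamma <= cos (pattern_arg M phi psi o).
    move=> Hi o; rewrite cos_pattern_arg.
    case: ifP => _; first by lra.
    case: ifP => [H|_]; last by lra.
    (* Otherwise the next index, which opens block [l + 1], would have offset [M] or [2 M] and hence
       end its block, forcing [M = 1]. *)
    exfalso.
    have Ho : (0 < o)%nat by move/orP: H => [] /Nat.eqb_eq; lia.
    have Ho' : (S o < 4 * M)%nat by move/orP: H => [] /Nat.eqb_eq; lia.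
    have E := offset_S (4 * M) (M * l + S i) Ho Ho'; rewrite -/o in E.
    have Hn : S (M * l + S i) = (M * S l + 1)%nat by lia.
    rewrite Hn in E; have He := Hend (S l) 0%nat ltac:(lia).
    move/orP: H => [] /Nat.eqb_eq H.
      by have := He 1%nat; lia.
    by have := He 2%nat; lia.
  have Hpair i : S (S i) = M ->
      let o := offset (4 * M) (M * l + S i) in
      cos (pattern_arg M phi psi o) = 1 \/
      cos (pattern_arg M phi psi o) = - d /\
      cos (pattern_arg M phi psi (offset (4 * M) (M * l + S (S i)))) = c.
    move=> Hi o; rewrite !cos_pattern_arg (Hcos0 i) -/o; last by lia.
    case: ifP => [H|_]; last by left.
    right; split=> //.
    have Ho : (0 < o)%nat by move/orP: H => [] /Nat.eqb_eq; lia.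
    have Ho' : (S o < 4 * M)%nat by move/orP: H => [] /Nat.eqb_eq; lia.
    by rewrite (Nat.add_succ_r _ (S i)) offset_S // H.
  move: Hcos0 Hcos1 Hlast Hpair => {Hend Habs Hext}.
  case: M HM => [|[|m]] HM; try lia.
  move=> Hcos0 Hcos1 Hlast Hpair b [Hb Hchain].
  apply: sum_ord_le_0_last2 => [i Hi | i j Hi Hj].
    (* Before the last two entries the cosine is 1, and [gamma <= 1]. *)
    have := Hb i; rewrite /block cos_pattern_arg Hcos0 ?Hcos1; try lia.
    by nra.
  have Hbi := Hb i; have Hbj := Hb j.
  have Hij : b i <= rho' * b j.
    have := Hchain i j ltac:(lia); rewrite Hi Hj.
    have : 0 < rho' ^ m by apply: pow_lt.
    have -> : rho' ^ S m * b j = rho' ^ m * (rho' * b j) by rewrite /=; ring.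
    by move=> Hpow; apply: Rmult_le_reg_l.
  rewrite /block Hi Hj.
  have := Hlast (S m) erefl; have := Hpair m erefl.
  move=> [-> | [-> ->]] => /= Hl.
    by nra.
  (* The cone bounds the loss at the next-to-last entry, and the equation for [gamma] identifies
     this bound with the gain [(c - gamma) * b j] at the last. *)
  have : (d + gamma) * b i <= (d + gamma) * (rho' * b j).
    by apply: Rmult_le_compat_l; lra.
  have -> : (d + gamma) * (rho' * b j) = (c - gamma) * b j.
    have -> : c = gamma * (1 + rho') + d * rho' by lra.
    by ring.
  lra.
Qed.

Theorem proposition5 :
  (forall (M : nat) (rho : R), (1 <= M)%nat -> 0 < rho ->
     exists (a : nat -> C) (theta : nat -> R),
       has_arguments a theta /\
       abscissa_abs_cv a = Finite 0 /\
       (forall l : nat,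
          Bcone M rho (block M (fun n => Cmod (a n)) l)) /\
       (forall l : nat,
          opp_set M (polar M (Bcone M rho))
            (block M (fun n => cos (theta n)) l)) /\
       has_holomorphic_extension_past_0 a)
  /\
  (forall (M : nat) (rho' rho : R), (2 <= M)%nat -> 0 < rho' -> rho' < rho ->
     exists (gamma : R) (a : nat -> C) (theta : nat -> R),
       0 < gamma /\
       has_arguments a theta /\
       abscissa_abs_cv a = Finite 0 /\
       (forall l : nat,
          Bcone M rho (block M (fun n => Cmod (a n)) l)) /\
       (forall l : nat,
          translate_set M (opp_set M (polar M (Bcone M rho')))
            (fun _ => gamma)
            (block M (fun n => cos (theta n)) l)) /\
       has_holomorphic_extension_past_0 a).
Proof.
by split; [exact: pattern_same_cone | exact: pattern_smaller_cone].
Qed.
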